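(* Let $A$ be a non-empty subset of $\mathbb{N}$ and let $F$ be a positive integer. Then $\mathscr{S}(A,F)\neq\emptyset$ if and only if $F\notin\langle A\rangle$.
   Context: $\mathbb{N}=\{0,1,2,\ldots\}$. $\langle A\rangle$ is the submonoid of $(\mathbb{N},+)$ generated by $A$. A numerical semigroup is a submonoid $S$ of $(\mathbb{N},+)$ with $\mathbb{N}\setminus S$ finite; its Frobenius number $\mathrm{F}(S)$ is the greatest integer not belonging to $S$. $\mathscr{S}(A,F)$ is the set of all numerical semigroups $S$ such that $A\subseteq S$ and $\mathrm{F}(S)=F$. *)

(* Defs.v *)
From mathcomp Require Import all_boot all_order all_algebra.
From mathcomp Require Import all_classical.

Set Implicit Arguments.
Unset Strict Implicit.
Unset Printing Implicit Defensive.

Local Open Scope classical_set_scope.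

Definition submonoid (S : set nat) : Prop :=
  S 0%N /\ (forall x y : nat, S x -> S y -> S (x + y)%N).

Definition generated_submonoid (A : set nat) : set nat :=
  smallest submonoid A.

Definition numerical_semigroup (S : set nat) : Prop :=
  submonoid S /\ finite_set (~` S).

(* The greatest element is taken among all integers, not only the naturals,
   so that the Frobenius number of the whole of nat is -1. *)
Definition is_frobenius_number (S : set nat) (f : int) : Prop :=
  let outside := ~` (Posz @` S) in outside f /\ ubound outside f.

Definition semigroups_with_frobenius (A : set nat) (F : nat) :
    set (set nat) :=
  [set S | [/\ numerical_semigroup S, A `<=` S
             & is_frobenius_number S (Posz F)]].

(* Main.v *)
Require Import Defs.
From mathcomp Require Import all_boot all_order all_algebra.
From mathcomp Require Import all_classical.

(** If [S] is a numerical semigroup containing [A] with Frobenius number [F],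
    then [S] contains the submonoid generated by [A] and misses [F], so [F] is
    not generated by [A].  Conversely, adjoin to the submonoid generated by [A]
    every integer beyond [F]: the integers beyond [F] absorb addition, so the
    result is still a submonoid ([submonoid_setU_gt]); its complement lies in
    [0, F], and it misses [F] exactly when [A] does not generate [F]. *)

Local Open Scope classical_set_scope.

Lemma submonoid_generated (A : set nat) : submonoid (generated_submonoid A).
Proof.
split=> [M [[M0 _] _] //|x y Ax Ay M MA].
by have [[_ MD] _] := MA; apply: MD; [apply: Ax | apply: Ay].
Qed.

Lemma submonoid_setU_gt (M : set nat) (F : nat) :
  submonoid M -> submonoid (M `|` [set n | (F < n)%N]).
Proof.
move=> [M0 MD]; split; first by left.
move=> x y [Mx|/= Fx] [My|/= Fy]; first by left; apply: MD.
- by right; apply: leq_trans Fy (leq_addl _ _).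
- by right; apply: leq_trans Fx (leq_addr _ _).
- by right; apply: leq_trans Fx (leq_addr _ _).
Qed.

Lemma numerical_semigroup_setU_gt (M : set nat) (F : nat) :
  submonoid M -> numerical_semigroup (M `|` [set n | (F < n)%N]).
Proof.
move=> smM; split; first exact: submonoid_setU_gt.
apply: (sub_finite_set _ (finite_II F.+1)) => n /= nS.
by rewrite ltnS leqNgt; apply/negP => Fn; apply: nS; right.
Qed.

Lemma is_frobenius_number_setU_gt (M : set nat) (F : nat) :
  ~ M F -> is_frobenius_number (M `|` [set n | (F < n)%N]) (Posz F).
Proof.
move=> nMF; split=> [[n [Mn|/= Fn] [nF]]|[n|n] //= nS].
- by apply: nMF; rewrite -nF.
- by rewrite nF ltnn in Fn.
- rewrite lez_nat leqNgt; apply/negP => Fn.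
  by apply: nS; exists n => //; right.
Qed.

Theorem proposition3p1 (A : set nat) (F : nat)
    (A_neq0 : A !=set0) (F_gt0 : (0 < F)%N) :
  semigroups_with_frobenius A F !=set0 <-> ~ generated_submonoid A F.
Proof.
split=> [[S [[smS _] AS [nSF _]]] AF|nAF].
  by apply: nSF; exists F => //; apply: AF.
exists (generated_submonoid A `|` [set n | (F < n)%N]); split.
- exact/numerical_semigroup_setU_gt/submonoid_generated.
- by move=> a Aa; left; apply: sub_smallest Aa.
- exact: is_frobenius_number_setU_gt.
Qed.
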